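(* For the bilinear form on $\Pi(\mathbf x)$ defined by $\langle m_\pi,h_\sigma\rangle=n!\delta_{\pi,\sigma}$, the following hold for all set partitions $\pi,\sigma$ of $[n]$: $\langle e_\pi,e_\sigma\rangle=n!(\pi\wedge\sigma)!$; $\langle e_\pi,h_\sigma\rangle=n!\delta_{\pi\wedge\sigma,\hat0}$; $\langle e_\pi,p_\sigma\rangle=(-1)^\sigma n!\zeta(\sigma,\pi)$; $\langle e_\pi,m_\sigma\rangle=(-1)^\sigma n!\lambda(\sigma,\pi)!\zeta(\sigma,\pi)$; $\langle h_\pi,h_\sigma\rangle=n!(\pi\wedge\sigma)!$; $\langle h_\pi,p_\sigma\rangle=n!\zeta(\sigma,\pi)$; $\langle h_\pi,m_\sigma\rangle=n!\delta_{\pi,\sigma}$; $\langle p_\pi,p_\sigma\rangle=n!\frac{\delta_{\pi,\sigma}}{|\mu(\hat0,\pi)|}$; $\langle p_\pi,m_\sigma\rangle=n!\frac{\mu(\sigma,\pi)\zeta(\sigma,\pi)}{|\mu(\hat0,\pi)|}$; $\langle m_\pi,m_\sigma\rangle=n!\sum_{\tau\ge\pi\vee\sigma}\frac{\mu(\pi,\tau)\mu(\sigma,\tau)}{|\mu(\hat0,\tau)|}$. In particular each of these formulas defines the same bilinear form.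
   Context: $\Pi(\mathbf{x})$ is the algebra of bounded-degree elements of $\mathbb{Q}\langle\langle x_1,x_2,\ldots\rangle\rangle$ (noncommuting variables) invariant under all permutations of the variables; the form is extended bilinearly and is $0$ between partitions of different sets. Set partitions of $[n]$ form the refinement lattice $\Pi_n$ with meet $\wedge$, join $\vee$, minimum $\hat0$, Möbius function $\mu$, and zeta function $\zeta(\sigma,\pi)=1$ if $\sigma\le\pi$, $0$ otherwise. For a set partition $\tau$ with block sizes $b_i$, $\tau!=\prod b_i!$; $(-1)^\sigma$ is the sign of a permutation whose cycles are the blocks of $\sigma$; for $\sigma\le\pi$, $\lambda(\sigma,\pi)$ is the integer partition whose parts are the numbers of blocks of $\sigma$ contained in each block of $\pi$, and $\lambda(\sigma,\pi)!$ is the product of factorials of its parts. With sums over $n$-tuples $(i_1,\dots,i_n)$ of positive integers: $m_\pi=\sum x_{i_1}\cdots x_{i_n}$ with $i_j=i_k$ iff $j,k$ in the same block of $\pi$; $p_\pi=\sum x_{i_1}\cdots x_{i_n}$ with $i_j=i_k$ whenever $j,k$ in the same block; $e_\pi=\sum x_{i_1}\cdots x_{i_n}$ with $i_j\neq i_k$ whenever $j\ne k$ in the same block. For $f:[n]\to\{x_1,x_2,\ldots\}$ let $\ker f$ be the set partition of nonempty fibers, $M_f=f(1)\cdots f(n)$; then $h_\pi=\sum_{(f,L)}M_f$ over pairs with $L$ a linear ordering of each block of $(\ker f)\wedge\pi$. *)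

(* Defs.v *)
From HB Require Import structures.
From mathcomp Require Import all_boot all_order all_algebra all_fingroup.
From mathcomp Require Import boolp functions.

Set Implicit Arguments.
Unset Strict Implicit.
Unset Printing Implicit Defensive.

Import Order.TTheory GRing.Theory Num.Theory.
Local Open Scope ring_scope.

(** * The lattice of set partitions of [n]; [n] is rendered as ['I_n] *)

Record setpart (n : nat) := SetPart {
  blocks :> {set {set 'I_n}};
  blocksP : partition blocks [set: 'I_n] }.

HB.instance Definition _ n := [isSub for @blocks n].
HB.instance Definition _ n := [Finite of setpart n by <:].

Definition same_block n (P : {set {set 'I_n}}) : rel 'I_n :=
  fun i j => pblock P i == pblock P j.

Lemma in_cover n (p : setpart n) i : i \in cover p.
Proof. by rewrite (cover_partition (blocksP p)) in_setT. Qed.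

Lemma same_blockE n (p : setpart n) i j : same_block p i j = (j \in pblock p i).
Proof.
by apply: eq_pblock; [exact: partition_trivIset (blocksP p) | exact: in_cover].
Qed.

Lemma setpart_eq n (p q : setpart n) :
  same_block p =2 same_block q -> p = q.
Proof.
move=> e; apply: val_inj => /=.
rewrite -(equivalence_partition_pblock (blocksP p)).
rewrite -(equivalence_partition_pblock (blocksP q)).
apply: eq_imset => i; apply/setP => j; rewrite !inE /=.
by rewrite -!same_blockE e.
Qed.

Definition refines n (p q : setpart n) : bool :=
  [forall A in blocks p, exists B in blocks q, A \subset B].

Lemma refinesP n (p q : setpart n) :
  reflect (subrel (same_block p) (same_block q)) (refines p q).
Proof.
apply: (iffP forall_inP) => [h i j | h A Ap].
  rewrite same_blockE => ji.
  have /exists_inP[B Bq /subsetP sAB] := h _ (pblock_mem (in_cover p i)).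
  have iB : i \in B by apply: sAB; rewrite mem_pblock in_cover.
  have jB : j \in B by apply: sAB.
  by rewrite same_blockE (def_pblock (partition_trivIset (blocksP q)) Bq iB).
have /set0Pn[i iA] := partition_neq0 (blocksP p) Ap.
apply/exists_inP; exists (pblock q i); first exact/pblock_mem/in_cover.
apply/subsetP => j jA; rewrite -same_blockE; apply: h.
by rewrite same_blockE (def_pblock (partition_trivIset (blocksP p)) Ap iA).
Qed.

Fact setpart_display : Order.disp_t. Proof. exact: Order.Disp tt tt. Qed.

Lemma refines_refl n : reflexive (@refines n).
Proof. by move=> p; apply/refinesP. Qed.

Lemma refines_anti n : antisymmetric (@refines n).
Proof.
move=> p q /andP[/refinesP h1 /refinesP h2]; apply: setpart_eq => i j.
by apply/idP/idP; [exact: h1 | exact: h2].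
Qed.

Lemma refines_trans n : transitive (@refines n).
Proof.
by move=> q p r /refinesP h1 /refinesP h2; apply/refinesP => i j /h1/h2.
Qed.

HB.instance Definition _ n := Order.Le_isPOrder.Build setpart_display (setpart n)
  (@refines_refl n) (@refines_anti n) (@refines_trans n).

Definition partition_of_rel n (R : rel 'I_n)
    (eR : {in [set: 'I_n] & &, equivalence_rel R}) : setpart n :=
  SetPart (equivalence_partitionP eR).

Lemma partition_of_relE n (R : rel 'I_n) eR :
  same_block (@partition_of_rel n R eR) =2 R.
Proof.
by move=> i j; rewrite same_blockE pblock_equivalence_partition ?in_setT.
Qed.

(* The blocks of the meet are the nonempty pairwise intersections of blocks
   (see [setpart_meetE]). *)
Lemma meet_equiv n (p q : setpart n) :
  {in [set: 'I_n] & &,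
     equivalence_rel (fun i j => same_block p i j && same_block q i j)}.
Proof.
move=> i j k _ _ _; rewrite /same_block !eqxx; split=> //.
by move=> /andP[/eqP-> /eqP->].
Qed.

Definition setpart_meet n (p q : setpart n) : setpart n :=
  partition_of_rel (meet_equiv p q).

(* The blocks of the join are the connected components of the graph linking
   two elements when they share a block of p or a block of q. *)
Definition join_rel n (p q : setpart n) : rel 'I_n :=
  fun i j => same_block p i j || same_block q i j.

Lemma join_equiv n (p q : setpart n) :
  {in [set: 'I_n] & &, equivalence_rel (connect (join_rel p q))}.
Proof.
have csym : connect_sym (join_rel p q).
  apply: sym_connect_sym => i j.
  by rewrite /join_rel /same_block ![pblock _ j == _]eq_sym.
by move=> i j k _ _ _; split=> // ij; apply: same_connect.
Qed.

Definition setpart_join n (p q : setpart n) : setpart n :=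
  partition_of_rel (join_equiv p q).

Lemma setpart_lexI n (r p q : setpart n) :
  (r <= setpart_meet p q)%O = (r <= p)%O && (r <= q)%O.
Proof.
apply/refinesP/andP => [h | [/refinesP hp /refinesP hq] i j rij].
  by split; apply/refinesP => i j /h; rewrite partition_of_relE => /andP[].
by rewrite partition_of_relE hp // hq.
Qed.

Lemma setpart_leUx n (p q r : setpart n) :
  (setpart_join p q <= r)%O = (p <= r)%O && (q <= r)%O.
Proof.
apply/refinesP/andP => [h | [/refinesP hp /refinesP hq] i j].
  by split; apply/refinesP => i j ij; apply: h; rewrite partition_of_relE;
    apply: connect1; rewrite /join_rel ij ?orbT.
rewrite partition_of_relE => /connectP[s sP ->] {j}.
elim: s i sP => //= [i _|j s IH i /andP[ij /IH]]; first exact: eqxx.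
suff /eqP e : same_block r i j by rewrite /same_block e.
by case/orP: ij => [/hp|/hq].
Qed.

HB.instance Definition _ n := Order.POrder_isMeetSemilattice.Build
  setpart_display (setpart n) (@setpart_lexI n).
HB.instance Definition _ n := Order.POrder_isJoinSemilattice.Build
  setpart_display (setpart n) (@setpart_leUx n).

Lemma singletons_partition n :
  partition [set [set i] | i : 'I_n] [set: 'I_n].
Proof.
apply/and3P; split.
- rewrite eqEsubset subsetT; apply/subsetP => i _; apply/bigcupP.
  by exists [set i]; rewrite ?inE // imset_f.
- apply/trivIsetP => A B /imsetP[i _ ->] /imsetP[j _ ->] ij.
  by rewrite disjoints1 inE; apply: contra ij => /eqP ->.
- by apply/imsetP => -[i _ /esym/eqP]; rewrite -cards_eq0 cards1.
Qed.

Definition singletons n : setpart n := SetPart (singletons_partition n).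

Lemma singletons_le n (p : setpart n) : (singletons n <= p)%O.
Proof.
apply/forall_inP => A /imsetP[i _ ->]; apply/exists_inP.
exists (pblock p i); first exact/pblock_mem/in_cover.
by rewrite sub1set mem_pblock in_cover.
Qed.

HB.instance Definition _ n :=
  Order.hasBottom.Build setpart_display (setpart n) (@singletons_le n).

Lemma setpart_meetE n (p q : setpart n) :
  blocks (p `&` q)%O =
  [set A :&: B | A in blocks p, B in blocks q] :\ set0.
Proof.
have tp := partition_trivIset (blocksP p).
have tq := partition_trivIset (blocksP q).
apply/setP => C; rewrite !inE; apply/imsetP/andP => [[i _ ->] | []].
  have -> : [set j in [set: 'I_n] | same_block p i j && same_block q i j] =
            pblock p i :&: pblock q i.
    by apply/setP => j; rewrite !inE /= !same_blockE.
  split; first by apply/set0Pn; exists i; rewrite inE !mem_pblock !in_cover.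
  by apply: imset2_f; apply/pblock_mem/in_cover.
case/set0Pn => i iC /imset2P[A B Ap Bq eC]; exists i => //.
move: iC; rewrite eC inE => /andP[iA iB]; apply/setP => j.
by rewrite !inE !same_blockE (def_pblock tp Ap iA) (def_pblock tq Bq iB).
Qed.

(** * Möbius function of a finite poset *)

(* mu(x, x) = 1 and mu(x, y) = - sum_(x <= z < y) mu(x, z) for x < y; it is 0
   unless x <= y. The recursion is run with fuel #|T|, which exceeds the length
   of every chain below y: see the characterization [mobius_lt]. *)
Fixpoint mobius_rec d (T : finPOrderType d) (k : nat) (x y : T) : rat :=
  if x == y then 1 else
  if k is k'.+1 then
    if (x < y)%O then - \sum_(z : T | (x <= z < y)%O) mobius_rec k' x z else 0
  else 0.

Definition mobius d (T : finPOrderType d) (x y : T) : rat :=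
  mobius_rec #|T| x y.

Section MobiusTheory.
Context d (T : finPOrderType d).
Implicit Types x y z : T.

Lemma mobius_rec_fuel x y k l :
  (#|[set z | (z < y)%O]| <= k)%N -> (#|[set z | (z < y)%O]| <= l)%N ->
  mobius_rec k x y = mobius_rec l x y.
Proof.
elim: k l y => [|k IH] [|l] y //= hk hl; case: eqP => // _.
- case: ifP => // xy; move: hk; rewrite leqn0 cards_eq0 => /eqP/setP/(_ x).
  by rewrite !inE xy.
- case: ifP => // xy; move: hl; rewrite leqn0 cards_eq0 => /eqP/setP/(_ x).
  by rewrite !inE xy.
case: ifP => // _; congr (- _); apply: eq_bigr => z /andP[_ zy].
have sub : (#|[set t | (t < z)%O]| < #|[set t | (t < y)%O]|)%N.
  apply: proper_card; apply/properP; split.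
    by apply/subsetP => t; rewrite !inE => /lt_trans; apply.
  by exists z; rewrite !inE ?ltxx.
by apply: IH; rewrite -ltnS; apply: leq_trans sub _.
Qed.

Lemma mobius_refl x : mobius x x = 1.
Proof. by rewrite /mobius; case: #|T| => [|k] /=; rewrite eqxx. Qed.

Lemma mobius_nle x y : ~~ (x <= y)%O -> mobius x y = 0.
Proof.
move=> nxy; rewrite /mobius.
have xy : x == y = false by apply/eqP => e; rewrite e lexx in nxy.
have lxy : (x < y)%O = false by apply/negP => /ltW; exact/negP.
by case: #|T| => [|k] /=; rewrite xy ?lxy.
Qed.

Lemma mobius_lt x y : (x < y)%O ->
  mobius x y = - \sum_(z : T | (x <= z < y)%O) mobius x z.
Proof.
move=> xy; rewrite {1}/mobius -(@mobius_rec_fuel x y #|T|.+1).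
- by rewrite /= xy lt_eqF.
- by apply: leq_trans (max_card _) _.
- exact: max_card.
Qed.

End MobiusTheory.

(** * Statistics of set partitions *)

Definition part_fact n (t : setpart n) : nat := \prod_(B in blocks t) #|B|`!.

Definition part_lambda n (s p : setpart n) : seq nat :=
  sort geq [seq #|[set A in blocks s | A \subset B]| | B : {set 'I_n} <- enum (blocks p)].

Definition lambda_fact n (s p : setpart n) : nat :=
  \prod_(c <- part_lambda s p) c`!.

Definition zeta n (s p : setpart n) : rat := (s <= p)%O%:R.

(* (-1)^s is the sign of a permutation whose cycles are the blocks of s;
   [part_perm_exists] and [part_signE] show that such a permutation exists and
   that its sign depends on s only. *)
Definition part_sign n (s : setpart n) : rat :=
  if [pick g : 'S_n | porbits g == blocks s] is Some g
  then (-1) ^+ (g : bool) else 0.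

Lemma part_signE n (s : setpart n) (g : 'S_n) :
  porbits g = blocks s -> part_sign s = (-1) ^+ (g : bool).
Proof.
move=> gs; rewrite /part_sign; case: pickP => [h /eqP hs | /(_ g)].
  by rewrite /odd_perm hs gs.
by rewrite gs eqxx.
Qed.

Lemma part_perm_exists n (s : setpart n) :
  exists g : 'S_n, porbits g = blocks s.
Proof.
have ts := partition_trivIset (blocksP s).
pose c i := enum (pblock s i).
have ic i : i \in c i by rewrite mem_enum mem_pblock in_cover.
pose f i := next (c i) i.
have fc i : f i \in c i by rewrite mem_next.
have cf i : c (f i) = c i.
  congr (enum (pred_of_set _)); apply/eqP.
  have := fc i; rewrite mem_enum -same_blockE /same_block eq_sym; exact.
have finj : injective f.
  move=> i j e; have ec : c i = c j by rewrite -cf e cf.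
  apply: (can_inj (prev_next (enum_uniq (pblock s i)))).
  by rewrite -/(c i) -/(f i) e /f ec.
exists (perm finj); set g := perm finj.
have orb i : porbit g i = pblock s i.
  have cyc : fcycle g (c i).
    have : fcycle (next (c i)) (c i) by apply: cycle_next; exact: enum_uniq.
    apply: (sub_in_cycle _ (allss (c i))) => j k ji _ /= /eqP <-.
    rewrite permE /f; suff -> : c j = c i by [].
    congr (enum (pred_of_set _)); apply/eqP; rewrite eq_sym.
    by rewrite -[_ == _]/(same_block s i j) same_blockE -mem_enum.
  apply/setP => j; rewrite -[j \in pblock s i]mem_enum -/(c i).
  rewrite -(fconnect_cycle cyc (ic i)); apply/porbitP/idP => [[k ->] | ij].
    by rewrite permX fconnect_iter.
  by exists (findex g i j); rewrite permX iter_findex.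
apply/setP => B; apply/imsetP/idP => [[i _ ->] | Bs].
  by rewrite orb; apply/pblock_mem/in_cover.
have /set0Pn[i iB] := partition_neq0 (blocksP s) Bs.
by exists i => //; rewrite orb (def_pblock ts Bs iB).
Qed.

(** * Symmetric functions in noncommuting variables *)

(* A series in Q<<x_1, x_2, ...>> is the family of its coefficients, indexed by
   words; the letter i stands for the variable x_(i+1). Only the vector space
   structure is used; [rat^o] is Q as a module over itself. *)
Notation ncseries := (seq nat -> rat^o).

Definition bounded_degree (f : ncseries) : Prop :=
  exists d : nat, forall w, (d < size w)%N -> f w = 0.

Definition perm_invariant (f : ncseries) : Prop :=
  forall s : nat -> nat, bijective s -> forall w, f (map s w) = f w.

Definition ncsym_pred : {pred ncseries} :=
  fun f => `[< bounded_degree f /\ perm_invariant f >].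

Lemma ncsym_submod_closed : submod_closed ncsym_pred.
Proof.
split; first by apply/asboolP; split; [exists 0%N | ].
move=> a f g /asboolP[[df hf] sf] /asboolP[[dg hg] sg]; apply/asboolP; split.
  exists (maxn df dg) => w; rewrite gtn_max => /andP[wf wg].
  by rewrite !fctE hf // hg // scaler0 addr0.
by move=> s bs w; rewrite !fctE sf // sg.
Qed.

HB.instance Definition _ := GRing.isSubmodClosed.Build rat ncseries
  ncsym_pred ncsym_submod_closed.

(* The underlying Q-vector space of the algebra Pi(x). *)
Record ncsym := NCSym {
  nccoef :> ncseries;
  nccoefP : nccoef \in ncsym_pred }.

HB.instance Definition _ := [isSub for nccoef].
HB.instance Definition _ := [Choice of ncsym by <:].
HB.instance Definition _ := [SubChoice_isSubLmodule of ncsym by <:].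

(* The formal sum over all n-tuples (i_1, ..., i_n) of
   c(i_1, ..., i_n) x_(i_1) ... x_(i_n). *)
Definition tuple_sum n (c : n.-tuple nat -> rat) : ncseries :=
  fun w => if insub w is Some t then c t else 0.

Lemma tuple_sum_ncsym n (c : n.-tuple nat -> rat) :
  (forall (s : nat -> nat) t, injective s -> c (map_tuple s t) = c t) ->
  tuple_sum c \in ncsym_pred.
Proof.
move=> cs; apply/asboolP; split.
  exists n => w nw; rewrite /tuple_sum; case: insubP => // t.
  by move=> /eqP e; rewrite e ltnn in nw.
move=> s /bij_inj injs w; rewrite /tuple_sum; case: insubP => [t st et | nst].
  case: insubP => [u su eu | /negP[]]; last by rewrite size_map in st.
  by rewrite -(cs s u injs); congr c; apply: val_inj; rewrite /= et eu.
by case: insubP => // u su; rewrite size_map su in nst.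
Qed.

(* ker f, for f : [n] -> {x_1, x_2, ...} given as the tuple of its values. *)
Definition ker n (f : n.-tuple nat) : setpart n :=
  SetPart (preim_partitionP (tnth f) [set: 'I_n]).

Definition linear_order_on n (B : {set 'I_n}) (L : {set 'I_n * 'I_n}) : bool :=
  [&& [forall i in B, forall j in B,
         ((i, j) \in L) && ((j, i) \in L) ==> (i == j)],
      [forall i in B, forall j in B, forall k in B,
         ((i, j) \in L) && ((j, k) \in L) ==> ((i, k) \in L)]
    & [forall i in B, forall j in B, ((i, j) \in L) || ((j, i) \in L)]].

(* The families of linear orderings, one on each block of p; such a family is
   encoded as the disjoint union of the (non-strict) order relations. *)
Definition block_orderings n (p : setpart n) : {set {set 'I_n * 'I_n}} :=
  [set L : {set 'I_n * 'I_n} |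
     (L \subset \bigcup_(B in blocks p) setX B B) &&
     [forall B in blocks p, linear_order_on B L]].

Definition m_series n (p : setpart n) : ncseries :=
  tuple_sum (fun i : n.-tuple nat =>
    [forall j, forall k, (tnth i j == tnth i k) == same_block p j k]%:R).

Definition p_series n (p : setpart n) : ncseries :=
  tuple_sum (fun i : n.-tuple nat =>
    [forall j, forall k, same_block p j k ==> (tnth i j == tnth i k)]%:R).

Definition e_series n (p : setpart n) : ncseries :=
  tuple_sum (fun i : n.-tuple nat =>
    [forall j, forall k,
       (j != k) && same_block p j k ==> (tnth i j != tnth i k)]%:R).

(* The coefficient of M_f in the sum of M_f over the pairs (f, L) is the number
   of L, as M_f determines f. *)
Definition h_series n (p : setpart n) : ncseries :=
  tuple_sum (fun f : n.-tuple nat => #|block_orderings (ker f `&` p)%O|%:R).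

Lemma ker_map n (s : nat -> nat) (f : n.-tuple nat) :
  injective s -> ker (map_tuple s f) = ker f.
Proof.
move=> injs; apply: val_inj; rewrite /= /preim_partition.
apply: eq_imset => i; apply/setP => j.
by rewrite !inE /= !tnth_map (inj_eq injs).
Qed.

Lemma m_series_ncsym n (p : setpart n) : m_series p \in ncsym_pred.
Proof.
apply: tuple_sum_ncsym => s t injs; congr (nat_of_bool _)%:R.
by apply: eq_forallb => j; apply: eq_forallb => k; rewrite !tnth_map (inj_eq injs).
Qed.

Lemma p_series_ncsym n (p : setpart n) : p_series p \in ncsym_pred.
Proof.
apply: tuple_sum_ncsym => s t injs; congr (nat_of_bool _)%:R.
by apply: eq_forallb => j; apply: eq_forallb => k; rewrite !tnth_map (inj_eq injs).
Qed.

Lemma e_series_ncsym n (p : setpart n) : e_series p \in ncsym_pred.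
Proof.
apply: tuple_sum_ncsym => s t injs; congr (nat_of_bool _)%:R.
by apply: eq_forallb => j; apply: eq_forallb => k; rewrite !tnth_map (inj_eq injs).
Qed.

Lemma h_series_ncsym n (p : setpart n) : h_series p \in ncsym_pred.
Proof. by apply: tuple_sum_ncsym => s t injs; rewrite ker_map. Qed.

Definition ncm n (p : setpart n) : ncsym := NCSym (m_series_ncsym p).
Definition ncp n (p : setpart n) : ncsym := NCSym (p_series_ncsym p).
Definition nce n (p : setpart n) : ncsym := NCSym (e_series_ncsym p).
Definition nch n (p : setpart n) : ncsym := NCSym (h_series_ncsym p).

(** * Bilinear forms given by their values on a pair of families *)

Definition has_values (a b : forall n, setpart n -> ncsym)
    (F : forall n, setpart n -> setpart n -> rat) (B : {biscalar ncsym}) : Prop :=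
  (forall n (p s : setpart n), B (a n p) (b n s) = F n p s) /\
  (forall k n (p : setpart k) (s : setpart n),
     k <> n -> B (a k p) (b n s) = 0).

(* <a_p, b_s> = F(p, s), extended by 0 to partitions of different sets, holds
   for B and determines a bilinear form on Pi(x), which is then B. *)
Definition defined_by (a b : forall n, setpart n -> ncsym)
    (F : forall n, setpart n -> setpart n -> rat) (B : {biscalar ncsym}) : Prop :=
  has_values a b F B /\ forall B' : {biscalar ncsym}, has_values a b F B' -> B' =2 B.

(* Main.v *)
(* In the basis p the form is diagonal: <p_pi, p_sigma> = n! / |mu(0, pi)| if
   pi = sigma, and 0 otherwise. Moebius inversion on the words with a given
   kernel gives m_pi = sum_(tau >= pi) mu(pi, tau) p_tau,
   e_pi = sum_(tau <= pi) mu(0, tau) p_tau and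
   h_pi = sum_(tau <= pi) |mu(0, tau)| p_tau, so that each of the formulas
   becomes a sum of values of mu over an interval. The sums of |mu| come from
   the identity mu(sigma, tau) = (-1)^sigma (-1)^tau N(sigma, tau), where
   N(sigma, tau) counts the permutations of the blocks of sigma whose cycles
   merge these blocks into the blocks of tau: the sum over the tau in
   [sigma, pi] of the right hand side is the sum of the signs of the
   permutations of the blocks of sigma that preserve the blocks of pi, which
   vanishes unless pi = sigma, while the sum of N(sigma, tau) is their number
   lambda(sigma, pi)!. *)

Require Import Defs.
From HB Require Import structures.
From mathcomp Require Import all_boot all_order all_algebra all_fingroup.
From mathcomp Require Import boolp functions.

Set Implicit Arguments.
Unset Strict Implicit.
Unset Printing Implicit Defensive.

Import Order.TTheory GRing.Theory Num.Theory.
Local Open Scope ring_scope.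

(** * Möbius inversion *)

(** Enumerating [I] turns both functions into square matrices over a commutative ring, where a
    one-sided inverse is two-sided. *)
Lemma sum_mul1C (R : comUnitRingType) (I : finType) (A B : I -> I -> R) :
  (forall i j, \sum_k A i k * B k j = (i == j)%:R) ->
  forall i j, \sum_k B i k * A k j = (i == j)%:R.
Proof.
move=> AB i j.
have sE (f : I -> R) : \sum_k f k = \sum_(k < #|I|) f (enum_val k).
  by rewrite -(big_enum_val (A := I) f).
pose mx (f : I -> I -> R) : 'M[R]_#|I| :=
  \matrix_(k, l) f (enum_val k) (enum_val l).
have AB1 : mx A *m mx B = 1%:M.
  apply/matrixP => k l; rewrite !mxE -(inj_eq enum_val_inj) -AB sE.
  by apply: eq_bigr => m _; rewrite !mxE.
have := congr1 (fun C : 'M_ _ => C (enum_rank i) (enum_rank j)) (mulmx1C AB1).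
rewrite !mxE (inj_eq enum_rank_inj) => <-; rewrite sE.
by apply: eq_bigr => k _; rewrite !mxE !enum_rankK.
Qed.

Section MobiusInversion.
Context d (T : finPOrderType d).
Implicit Types x y z : T.

Lemma mobius_sumr x y :
  \sum_(z : T | (x <= z <= y)%O) mobius x z = (x == y)%:R.
Proof.
case: (boolP (x <= y)%O) => [|nxy]; last first.
  rewrite big_pred0 => [|z].
    by case: eqP => // e; rewrite e lexx in nxy.
  by apply/negP => /andP[/le_trans h /h]; apply/negP.
rewrite le_eqVlt => /predU1P[->|xy].
  by rewrite (big_pred1 y) ?mobius_refl ?eqxx // => z; rewrite /= -eq_le eq_sym.
rewrite lt_eqF // (bigD1 y) /=; last by rewrite lexx ltW.
rewrite mobius_lt //; apply/eqP; rewrite addrC subr_eq0; apply/eqP.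
by apply: eq_bigl => z; rewrite lt_neqAle -andbA [(z <= y)%O && _]andbC.
Qed.

(** The condition at y expresses f y through its values at smaller elements, so induction on the
    number of elements below y applies. This serves to recognise signed counts of permutations as
    Möbius values. *)
Lemma mobius_unique x (f : T -> rat) :
  (forall y, (x <= y)%O -> \sum_(z : T | (x <= z <= y)%O) f z = (x == y)%:R) ->
  forall y, (x <= y)%O -> f y = mobius x y.
Proof.
move=> fS y; have [k] := ubnP #|[set z | (z < y)%O]|.
elim: k y => // k IH y /ltnSE yk xy.
have := fS y xy; rewrite -mobius_sumr (bigD1 y) /= ?xy ?lexx //.
rewrite [X in _ = X](bigD1 y) /= ?xy ?lexx //.
set s1 := \sum_(_ | _) _; set s2 := \sum_(_ | _) _.
suff -> : s1 = s2 by apply: addIr.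
apply: eq_bigr => z /andP[/andP[xz zy] nzy]; apply: IH => //.
have {nzy}zy : (z < y)%O by rewrite lt_neqAle nzy.
apply: leq_trans yk; apply: proper_card; apply/properP; split.
  by apply/subsetP => t; rewrite !inE => /lt_trans; apply.
by exists z; rewrite !inE ?ltxx.
Qed.

(** By [mobius_sumr] the Möbius matrix times the order matrix is the identity; [sum_mul1C] swaps the
    two factors. *)
Lemma mobius_suml x y :
  \sum_(z : T | (x <= z <= y)%O) mobius z y = (x == y)%:R.
Proof.
rewrite -(sum_mul1C (A := @mobius _ T) (B := fun x y => (x <= y)%O%:R)).
  rewrite big_mkcond; apply: eq_bigr => z _.
  case: (boolP (z <= y)%O) => [_|/mobius_nle ->]; last by rewrite mulr0 andbF.
  by rewrite andbT; case: ifP; rewrite ?mul1r ?mul0r.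
move=> {}x {}y; rewrite -mobius_sumr [RHS]big_mkcond; apply: eq_bigr => z _.
case: (boolP (x <= z)%O) => [_|/mobius_nle ->]; last by rewrite mul0r.
by rewrite /=; case: ifP; rewrite ?mulr1 ?mulr0.
Qed.

End MobiusInversion.

(** * Möbius function of the partition lattice *)

Section BlockPerms.
Variable n : nat.
Implicit Types (p s t : setpart n) (X : {set 'I_n}) (g : 'S_n).

Lemma same_block_sym p : symmetric (same_block p).
Proof. by move=> i j; apply: eq_sym. Qed.

Lemma pblock_def p B i : B \in blocks p -> i \in B -> pblock p i = B.
Proof. exact: def_pblock (partition_trivIset (blocksP p)). Qed.

Lemma pblock_in p i : pblock p i \in blocks p.
Proof. exact/pblock_mem/in_cover. Qed.

Lemma pblock_self p i : i \in pblock p i.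
Proof. by rewrite mem_pblock in_cover. Qed.

(** * Permutations preserving every block *)

Definition block_perms p X : {set 'S_n} :=
  [set g : 'S_n | perm_on X g && [forall i, same_block p i (g i)]].

Lemma block_permsP p X g :
  reflect (perm_on X g /\ forall i, pblock p (g i) = pblock p i)
          (g \in block_perms p X).
Proof.
rewrite inE; apply: (iffP andP) => -[gX gp]; split=> //.
  by move=> i; apply/esym/eqP/(forallP gp).
by apply/forallP => i; rewrite /same_block gp.
Qed.

Lemma block_perms_mem p X g B i : g \in block_perms p X -> B \in blocks p ->
  (g i \in B) = (i \in B).
Proof.
case/block_permsP => _ gp Bp; apply/idP/idP => iB.
  by rewrite -(pblock_def Bp iB) gp pblock_self.
by rewrite -(pblock_def Bp iB) -gp pblock_self.
Qed.

(** Such a permutation is rebuilt from its restrictions to the blocks, which are arbitrary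
    permutations of the sets [B :&: X]. *)
Lemma card_block_perms p X :
  #|block_perms p X| = (\prod_(B in blocks p) #|B :&: X|`!)%N.
Proof.
(* The family is indexed by all subsets; those that are not blocks get only the identity and so
   contribute a factor 1. *)
pose F (B : {set 'I_n}) : pred 'S_n :=
  if B \in blocks p then perm_on (B :&: X) else pred1 1%g.
have -> : (\prod_(B in blocks p) #|B :&: X|`!)%N = #|family F|.
  rewrite card_family foldrE big_map big_enum [LHS]big_mkcond /=.
  apply: eq_bigr => B _; rewrite /F; case: ifP => _; last by rewrite card1.
  by rewrite card_perm.
pose phi g := [ffun B => if B \in blocks p then restr_perm B g else 1%g].
have rE g B i : g \in block_perms p X -> B \in blocks p -> i \in B ->
    restr_perm B g i = g i.
  move=> gp Bp iB; apply: restr_permE => //; apply/astabsP => j.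
  exact: block_perms_mem gp Bp.
have phi_inj : {in block_perms p X &, injective phi}.
  move=> g h gp hp /ffunP e; apply/permP => i.
  have := e (pblock p i); rewrite !ffunE pblock_in => /permP/(_ i).
  by rewrite !rE ?pblock_in ?pblock_self.
rewrite -(card_in_imset phi_inj); apply: eq_card => f.
apply/imsetP/familyP => [[g gp ->] B | fF].
  rewrite ffunE /F; case: ifP => Bp; last by rewrite inE.
  apply/subsetP => i; rewrite !inE => gi.
  have iB : i \in B.
    by apply: contraNT gi => iB; rewrite (out_perm (restr_perm_on _ _) iB).
  rewrite iB; move: gi; rewrite rE //=.
  by apply: contraNT => iX; case/block_permsP: gp => /out_perm ->.
have fon B : B \in blocks p -> perm_on (B :&: X) (f B).
  by move=> Bp; have := fF B; rewrite /F Bp.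
have fB B i : B \in blocks p -> (f B i \in B) = (i \in B).
  move=> Bp; case: (boolP (i \in B :&: X)) => iBX.
    have := iBX; rewrite -(perm_closed _ (fon B Bp)) => /setIP[-> _].
    by case/setIP: iBX => ->.
  by rewrite (out_perm (fon B Bp) iBX).
(* Gluing: each point is moved by the component of its own block, which keeps it in that block. *)
pose g0 i := f (pblock p i) i.
have g0p i : pblock p (g0 i) = pblock p i.
  by apply: pblock_def; rewrite ?pblock_in // fB ?pblock_in // pblock_self.
have g0_inj : injective g0.
  by move=> i j e; move: (e); rewrite /g0 -[pblock p i]g0p e g0p => /perm_inj.
have gp : perm g0_inj \in block_perms p X.
  apply/block_permsP; split=> [|i]; last by rewrite permE.
  apply/subsetP => i; rewrite inE permE; apply: contraR => iX; apply/eqP.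
  by apply: (out_perm (fon _ (pblock_in p i))); rewrite inE negb_and iX orbT.
exists (perm g0_inj) => //; apply/ffunP => B; rewrite ffunE.
case: ifP => Bp; last by have := fF B; rewrite /F Bp inE => /eqP.
apply/permP => i; case: (boolP (i \in B)) => iB.
  by rewrite rE // permE /g0 (pblock_def Bp iB).
rewrite (out_perm (restr_perm_on _ _) iB) (out_perm (fon B Bp)) //.
by rewrite inE negb_and iB.
Qed.

(** * Block representatives and merging of blocks *)

Definition rep s i : 'I_n := odflt i [pick j in pblock s i].

(** The default value in [rep] is never returned, because the block of i contains i. *)
Lemma rep_in s i : rep s i \in pblock s i.
Proof.
by rewrite /rep; case: pickP => [j|] //= /(_ i); rewrite pblock_self.
Qed.

Lemma pblock_rep s i : pblock s (rep s i) = pblock s i.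
Proof. exact: pblock_def (pblock_in s i) (rep_in s i). Qed.

(** The choice made by [pick] depends on the block only, so each block has exactly one
    representative. *)
Lemma eq_rep s i j : (rep s i == rep s j) = same_block s i j.
Proof.
apply/eqP/eqP => e; first by rewrite -pblock_rep e pblock_rep.
rewrite /rep e; case: pickP => //= /(_ j).
by rewrite pblock_self.
Qed.

Definition reps s := [set rep s i | i : 'I_n].

Lemma rep_id s x : x \in reps s -> rep s x = x.
Proof.
case/imsetP => i _ ->; apply/eqP.
by rewrite eq_rep /same_block pblock_rep.
Qed.

Lemma mem_reps s x : (x \in reps s) = (rep s x == x).
Proof.
by apply/idP/eqP => [/rep_id|<-] //; apply: imset_f.
Qed.

Lemma merge_equiv s g : {in [set: 'I_n] & &, equivalence_rel
  (fun i j => porbit g (rep s i) == porbit g (rep s j))}.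
Proof. by move=> i j k _ _ _; rewrite eqxx; split=> // /eqP ->. Qed.

(* A permutation of the blocks of s is encoded as a permutation g of 'I_n
   supported on [reps s]. *)
Definition merge s g : setpart n := partition_of_rel (merge_equiv s g).

Lemma mergeE s g i j :
  same_block (merge s g) i j = (porbit g (rep s i) == porbit g (rep s j)).
Proof. exact: partition_of_relE. Qed.

Lemma merge_ge s g : (s <= merge s g)%O.
Proof. by apply/refinesP => i j; rewrite mergeE -eq_rep => /eqP ->. Qed.

Lemma merge_le s p g : (s <= p)%O -> perm_on (reps s) g ->
  (merge s g <= p)%O = (g \in block_perms p (reps s)).
Proof.
move=> /refinesP sp gs.
have prep i : pblock p (rep s i) = pblock p i.
  by apply/eqP/sp; rewrite /same_block pblock_rep.
apply/refinesP/block_permsP => [h | [_ gp] i j].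
  split=> // i; case: (boolP (i \in reps s)) => [ir|/(out_perm gs) -> //].
  apply/esym/eqP; apply: h.
  rewrite mergeE !rep_id // ?(perm_closed _ gs) //.
  by rewrite -(porbit_perm g 1 i) expg1.
rewrite mergeE eq_porbit_mem => /porbitP[k e].
have pk l : pblock p ((g ^+ l)%g (rep s j)) = pblock p (rep s j).
  by elim: l => [|l IH]; rewrite ?expg0 ?perm1 // expgSr permM gp.
by rewrite /same_block -prep e pk prep.
Qed.

(** [h] sends a value of [f] to its fibre, and the fibres are exactly the blocks. *)
Lemma card_blocks (U : finType) (f : 'I_n -> U) t :
  (forall i j, (f i == f j) = same_block t i j) ->
  #|[set f i | i : 'I_n]| = #|blocks t|.
Proof.
move=> ft; pose h u := [set i | f i == u].
have hf i : h (f i) = pblock t i.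
  by apply/setP => j; rewrite inE ft same_block_sym same_blockE.
have h_inj : {in [set f i | i : 'I_n] &, injective h}.
  move=> _ _ /imsetP[i _ ->] /imsetP[j _ ->] /setP/(_ i).
  by rewrite !inE eqxx => /esym/eqP.
rewrite -(card_in_imset h_inj) -imset_comp; congr #|pred_of_set _|.
apply/setP => B; apply/imsetP/idP => [[i _ ->] | Bt].
  by rewrite /= hf pblock_in.
have /set0Pn[i iB] := partition_neq0 (blocksP t) Bt.
by exists i => //=; rewrite hf (pblock_def Bt iB).
Qed.

(** * Signs, and Möbius values as signed counts *)

Lemma part_sign_card s : part_sign s = (-1) ^+ (odd n (+) odd #|blocks s|).
Proof.
have [g gs] := part_perm_exists s.
by rewrite (part_signE gs) /odd_perm card_ord gs.
Qed.

Lemma part_sign_sqr s : part_sign s * part_sign s = 1.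
Proof. by rewrite part_sign_card -expr2 sqrr_sign. Qed.

Lemma norm_part_sign s : `|part_sign s| = 1.
Proof. by rewrite part_sign_card normr_sign. Qed.

Lemma card_reps s : #|reps s| = #|blocks s|.
Proof. by apply: card_blocks => i j; rewrite eq_rep. Qed.

(** The cycles of [g] meeting [reps s] correspond to the blocks of [merge s g]; the other points, n
    minus [#|blocks s|] in number, are fixed. *)
Lemma card_porbits_merge s g : perm_on (reps s) g ->
  (#|porbits g| + #|blocks s| = #|blocks (merge s g)| + n)%N.
Proof.
move=> gs; have fixg x : x \notin reps s -> porbit g x = [set x].
  move=> xs; apply/setP => y; rewrite inE; apply/porbitP/eqP => [[k ->]|->].
    elim: k => [|k IH]; first by rewrite expg0 perm1.
    by rewrite expgSr permM IH (out_perm gs).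
  by exists 0%N; rewrite expg0 perm1.
have -> : #|blocks (merge s g)| = #|porbit g @: reps s|.
  rewrite /reps -imset_comp; apply/esym/card_blocks => i j.
  by rewrite mergeE.
have -> : porbits g = porbit g @: reps s :|: set1 @: ~: reps s.
  apply/setP => B; apply/imsetP/setUP => [[x _ ->] | [] /imsetP[x xs ->]].
  - case: (boolP (x \in reps s)) => xs; first by left; apply: imset_f.
    by right; rewrite fixg // imset_f // inE.
  - by exists x.
  - by exists x => //; rewrite fixg //; move: xs; rewrite inE.
rewrite cardsU disjoint_setI0 ?cards0 ?subn0.
  rewrite -addnA; congr addn.
  rewrite card_imset; last exact: set1_inj.
  by rewrite -card_reps addnC cardsC card_ord.
rewrite -setI_eq0; apply/eqP/setP => B; rewrite !inE; apply/negP.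
case/andP => /imsetP[x xs ->] /imsetP[y ys /setP/(_ x)].
rewrite porbit_id inE => /esym/eqP xy.
by move: ys; rewrite inE -xy xs.
Qed.

Lemma part_sign_merge s g : perm_on (reps s) g ->
  part_sign s * part_sign (merge s g) = (-1) ^+ (g : bool).
Proof.
move=> /card_porbits_merge/(congr1 odd); rewrite !oddD !part_sign_card.
rewrite -signr_addb /odd_perm card_ord.
by case: (odd n) (odd _) (odd _) (odd _) => [] [] [] [].
Qed.

(** If s = p, every block of p holds a single representative and only the identity occurs. Otherwise
    two representatives share a block of p, and their transposition [u] pairs off terms of opposite
    sign. *)
Lemma sum_sign_block_perms s p : (s <= p)%O ->
  \sum_(g in block_perms p (reps s)) (-1) ^+ (g : bool) = (s == p)%:R :> rat.
Proof.
move=> sp; case: eqP => [<-|/eqP nsp].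
  rewrite (big_pred1 1%g) ?odd_perm1 // => g /=.
  apply/block_permsP/eqP => [[gs gp]|->]; last first.
    by split=> [|i]; rewrite ?perm_on1 ?perm1.
  apply/permP => i; rewrite perm1.
  case: (boolP (i \in reps s)) => [ir|/(out_perm gs) -> //].
  apply/eqP; have := eq_rep s (g i) i.
  by rewrite !rep_id ?(perm_closed _ gs) // /same_block gp eqxx => ->.
have [i [j [pij sij]]] : exists i j, same_block p i j /\ ~~ same_block s i j.
  have : ~~ (p <= s)%O by apply: contra nsp => ps; rewrite eq_le sp.
  case: (boolP [exists i, exists j, same_block p i j && ~~ same_block s i j]).
    by case/existsP => i /existsP[j /andP[? ?]]; exists i, j.
  move=> h /negP[]; apply/refinesP => i j pij; apply: contraR h => sij.
  by apply/existsP; exists i; apply/existsP; exists j; rewrite pij.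
set x := rep s i; set y := rep s j; set u := tperm x y.
have xy : x != y by rewrite eq_rep.
have prep k : pblock p (rep s k) = pblock p k.
  by apply/eqP/(refinesP _ _ sp); rewrite /same_block pblock_rep.
have us : perm_on (reps s) u.
  apply: subset_trans (tperm_on x y) _; apply/subsetP => k.
  by rewrite !inE => /orP[] /eqP ->; apply: imset_f.
have up k : pblock p (u k) = pblock p k.
  by rewrite /u; case: tpermP => // ->; rewrite !prep (eqP pij).
set G := block_perms p (reps s).
have ub g : ((u * g)%g \in G) = (g \in G).
  suff h f : f \in G -> (u * f)%g \in G.
    by apply/idP/idP; [move/h; rewrite mulgA tperm2 mul1g | exact: h].
  case/block_permsP => fs fp; apply/block_permsP; split; first exact: perm_onM.
  by move=> k; rewrite permM fp up.
(* g |-> u * g is a sign-reversing bijection of the index set. *)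
have : \sum_(g in G) (-1) ^+ (g : bool) =
     - \sum_(g in G) (-1) ^+ (g : bool) :> rat.
  rewrite {1}(reindex_inj (mulgI u)) -sumrN; apply: eq_big => //= g _.
  by rewrite odd_permM odd_tperm xy signr_addb mulN1r.
by move/eqP; rewrite -addr_eq0 -mulr2n mulrn_eq0 => /eqP.
Qed.

(** Sorting [block_perms p (reps s)] by the value of [merge s] turns the sign sum of
    [sum_sign_block_perms] into a sum over the interval from s to p. The signed counts thus satisfy
    the relation of [mobius_unique]. *)
Lemma mobius_merge s t : (s <= t)%O ->
  mobius s t = part_sign s * part_sign t *
    #|[set g | perm_on (reps s) g & merge s g == t]|%:R.
Proof.
move=> st; apply/esym; move: t st; apply: mobius_unique => p sp.
rewrite -sum_sign_block_perms //.
rewrite (partition_big (merge s) (fun z => (s <= z <= p)%O)) /=; last first.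
  move=> g gp; rewrite merge_ge merge_le //.
  by case/block_permsP: gp.
apply: eq_bigr => z /andP[sz zp]; rewrite mulr_natr -sumr_const.
apply: eq_big => [g | g].
  rewrite inE; apply/andP/andP => -[gs gz]; split=> //.
    by rewrite -merge_le // (eqP gz).
  by case/block_permsP: gs.
by rewrite inE => /andP[gs /eqP <-]; rewrite part_sign_merge.
Qed.

(** The third factor in [mobius_merge] is a cardinality, so the absolute value only removes the two
    signs. *)
Lemma norm_mobius s t :
  `|mobius s t| = part_sign s * part_sign t * mobius s t.
Proof.
case: (boolP (s <= t)%O) => [st|/mobius_nle ->]; last by rewrite normr0 mulr0.
rewrite mobius_merge // !normrM !norm_part_sign !mul1r normr_nat mulrA.
by rewrite mulrACA !part_sign_sqr !mul1r.
Qed.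

(** The sorting of [mobius_merge] again, each permutation now having weight 1. *)
Lemma sum_norm_mobius s p : (s <= p)%O ->
  \sum_(t : setpart n | (s <= t <= p)%O) `|mobius s t| =
  (\prod_(B in blocks p) #|B :&: reps s|`!)%:R.
Proof.
move=> sp; rewrite -card_block_perms -sum1_card natr_sum.
rewrite (partition_big (merge s) (fun z => (s <= z <= p)%O)) /=; last first.
  move=> g gp; rewrite merge_ge merge_le //.
  by case/block_permsP: gp.
apply: eq_bigr => z /andP[sz zp]; rewrite norm_mobius mobius_merge // mulrA.
rewrite mulrACA !part_sign_sqr !mul1r -sum1_card natr_sum.
apply: eq_bigl => g; rewrite inE; apply/andP/andP => -[gs gz]; split=> //.
  by rewrite -merge_le // (eqP gz).
by case/block_permsP: gs.
Qed.

(** * Intervals starting at the bottom, and the factorial of lambda *)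

Lemma pblock_bot i : pblock (\bot%O : setpart n) i = [set i].
Proof. by apply: pblock_def; [apply/imsetP; exists i | exact: set11]. Qed.

Lemma reps_bot : reps \bot%O = [set: 'I_n].
Proof.
apply/setP => i; rewrite mem_reps inE; apply/eqP.
have := rep_in \bot%O i.
by rewrite pblock_bot inE => /eqP.
Qed.

Lemma part_sign_bot : part_sign (\bot%O : setpart n) = 1.
Proof.
by rewrite part_sign_card -card_reps reps_bot cardsT card_ord addbb.
Qed.

Lemma norm_mobius_bot t : `|mobius \bot%O t| = part_sign t * mobius \bot%O t.
Proof. by rewrite norm_mobius part_sign_bot mul1r. Qed.

(** By [mobius_merge] it suffices to have one permutation whose cycles are the blocks of t. *)
Lemma mobius_bot_neq0 t : mobius \bot%O t != 0.
Proof.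
have [g gt] := part_perm_exists t.
rewrite mobius_merge ?le0x // !mulf_neq0 //.
- by rewrite -normr_eq0 norm_part_sign.
- by rewrite -normr_eq0 norm_part_sign.
rewrite pnatr_eq0 -lt0n card_gt0; apply/set0Pn; exists g; rewrite inE reps_bot.
apply/andP; split; first by apply/subsetP => i _; rewrite inE.
apply/eqP/setpart_eq => i j; rewrite mergeE.
rewrite !rep_id ?reps_bot // eq_porbit_mem porbit_sym same_blockE.
by rewrite (@pblock_def _ (porbit g i) i) ?porbit_id // -gt imset_f.
Qed.

Lemma sum_norm_mobius_bot p :
  \sum_(t : setpart n | (t <= p)%O) `|mobius \bot%O t| = (part_fact p)%:R.
Proof.
rewrite -[LHS](eq_bigl _ _ (fun t => andb_idl (fun _ => le0x t))).
rewrite sum_norm_mobius ?le0x // reps_bot; congr (_%:R).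
by apply: eq_bigr => B _; rewrite setIT.
Qed.

(** Each block of s inside B has its unique representative in B. *)
Lemma lambda_factE s p : (s <= p)%O ->
  lambda_fact s p = (\prod_(B in blocks p) #|B :&: reps s|`!)%N.
Proof.
move=> sp; rewrite /lambda_fact (perm_big _ (permEl (perm_sort _ _))) big_map.
rewrite big_enum /=; apply: eq_bigr => B Bp; congr _`!.
have pb_inj : {in B :&: reps s &, injective (pblock s)}.
  move=> x y /setIP[_ xr] /setIP[_ yr] e; rewrite -(rep_id xr) -(rep_id yr).
  by apply/eqP; rewrite eq_rep /same_block e.
rewrite -(card_in_imset pb_inj); apply: eq_card => A; rewrite inE.
have sB i : i \in B -> pblock s i \subset B.
  move=> iB; apply/subsetP => j; rewrite -same_blockE => /(refinesP _ _ sp).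
  by rewrite same_blockE (pblock_def Bp iB).
apply/andP/imsetP => [[As AB] | [x /setIP[xB _] ->]].
  have /set0Pn[i iA] := partition_neq0 (blocksP s) As.
  have eA := pblock_def As iA.
  exists (rep s i); last by rewrite pblock_rep.
  by rewrite inE imset_f // andbT (subsetP AB) // -eA rep_in.
by rewrite pblock_in sB.
Qed.

Lemma sum_norm_mobius_lambda s p : (s <= p)%O ->
  \sum_(t : setpart n | (s <= t <= p)%O) `|mobius s t| = (lambda_fact s p)%:R.
Proof. by move=> sp; rewrite lambda_factE // sum_norm_mobius. Qed.

End BlockPerms.

(** * Linear orderings of the blocks *)

Section BlockOrderings.
Variable n : nat.
Implicit Types (p : setpart n) (B : {set 'I_n}) (L : {set 'I_n * 'I_n}).
Implicit Types (i j k : 'I_n).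

Lemma linear_orderP B L :
  reflect [/\ {in B &, forall i j, (i, j) \in L -> (j, i) \in L -> i = j},
              {in B & &, forall i j k,
                 (i, j) \in L -> (j, k) \in L -> (i, k) \in L}
            & {in B &, forall i j, ((i, j) \in L) || ((j, i) \in L)}]
          (linear_order_on B L).
Proof.
apply: (iffP and3P) => [] [as_L tr_L to_L]; split.
- move=> i j iB jB ij ji; apply/eqP.
  have /forall_inP/(_ j jB)/implyP := forall_inP as_L i iB.
  by apply; rewrite ij.
- move=> i j k iB jB kB ij jk.
  have /forall_inP/(_ j jB)/forall_inP/(_ k kB)/implyP := forall_inP tr_L i iB.
  by apply; rewrite ij.
- by move=> i j iB jB; have /forall_inP := forall_inP to_L i iB; apply.
- apply/forall_inP => i iB; apply/forall_inP => j jB; apply/implyP.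
  by case/andP => ij ji; apply/eqP/as_L.
- apply/forall_inP => i iB; apply/forall_inP => j jB; apply/forall_inP => k kB.
  by apply/implyP => /andP[]; apply: tr_L.
- by apply/forall_inP => i iB; apply/forall_inP => j jB; apply: to_L.
Qed.

(** For a linear order on [B] and i in [B], this is the position of i counted from 1, since i itself
    is included. *)
Definition rank B L i := #|[set j in B | (j, i) \in L]|.

Lemma leq_rank B L i j : linear_order_on B L -> i \in B -> j \in B ->
  (rank B L i <= rank B L j)%N = ((i, j) \in L).
Proof.
case/linear_orderP => _ tr_L to_L iB jB; case: (boolP (_ \in L)) => ij.
  apply: subset_leq_card; apply/subsetP => k; rewrite !inE => /andP[kB ki].
  by rewrite kB (tr_L k i j).
have ji : (j, i) \in L by have := to_L i j iB jB; rewrite (negPf ij).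
apply: negbTE; rewrite -ltnNge; apply: proper_card; apply/properP; split.
  apply/subsetP => k; rewrite !inE => /andP[kB kj].
  by rewrite kB (tr_L k j i).
exists i; rewrite inE iB //=.
by have := to_L i i iB iB; rewrite orbb.
Qed.

Lemma rank_inj B L : linear_order_on B L -> {in B &, injective (rank B L)}.
Proof.
move=> lin i j iB jB e; have [as_L _ _] := linear_orderP _ _ lin.
by apply: as_L => //; rewrite -(leq_rank lin) // e.
Qed.

(** The ranks are [#|B|] distinct numbers between 1 and [#|B|], hence all of them. *)
Lemma rank_onto B L : linear_order_on B L ->
  [set inord (rank B L i) | i in B] = [set~ ord0] :> {set 'I_#|B|.+1}.
Proof.
move=> lin; have rB i : (rank B L i < #|B|.+1)%N.
  rewrite ltnS subset_leq_card //.
  by apply/subsetP => j; rewrite inE => /andP[].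
apply/eqP; rewrite eqEcard; apply/andP; split.
  apply/subsetP => _ /imsetP[i iB ->]; rewrite !inE -val_eqE /= inordK //.
  rewrite -lt0n card_gt0; apply/set0Pn; exists i; rewrite inE iB.
  by have [_ _ /(_ i i iB iB)] := linear_orderP _ _ lin; rewrite orbb.
rewrite cardsC1 card_ord card_in_imset // => i j iB jB /(congr1 val) /=.
by rewrite !inordK //; apply: rank_inj.
Qed.

Definition ord_order : {set 'I_n * 'I_n} :=
  [set ij : 'I_n * 'I_n | (ij.1 <= ij.2)%N].

Lemma ord_order_linear B : linear_order_on B ord_order.
Proof.
apply/linear_orderP; split=> [i j _ _|i j k _ _ _|i j _ _]; rewrite !inE /=.
- by move=> ij ji; apply/val_inj/eqP; rewrite eqn_leq ij.
- exact: leq_trans.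
- exact: leq_total.
Qed.

(** The natural order pulled back along g; only pairs inside a block are kept, as the encoding of
    [block_orderings] demands. *)
Definition perm_ordering p (g : 'S_n) : {set 'I_n * 'I_n} :=
  [set ij : 'I_n * 'I_n | same_block p ij.1 ij.2 && (g ij.1 <= g ij.2)%N].

Lemma perm_ordering_in p (g : 'S_n) :
  perm_ordering p g \in block_orderings p.
Proof.
rewrite inE; apply/andP; split.
  apply/subsetP => -[i j]; rewrite inE /= => /andP[ij _].
  apply/bigcupP; exists (pblock p i); first exact: pblock_in.
  by rewrite inE /= pblock_self -same_blockE ij.
apply/forall_inP => B Bp; have sB i j : i \in B -> j \in B -> same_block p i j.
  by move=> iB jB; rewrite same_blockE (pblock_def Bp iB).
apply/linear_orderP; split=> [i j iB jB|i j k iB jB kB|i j iB jB];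
  rewrite !inE /= !sB //=.
- by move=> ij ji; apply/(@perm_inj _ g)/val_inj/eqP; rewrite eqn_leq ij.
- exact: leq_trans.
- exact: leq_total.
Qed.

Lemma rank_perm_ordering p (g : 'S_n) B i :
  g \in block_perms p setT -> B \in blocks p -> i \in B ->
  rank B (perm_ordering p g) i = rank B ord_order (g i).
Proof.
move=> gp Bp iB; rewrite /rank -(card_imset _ (@perm_inj _ g)).
apply: eq_card => k; rewrite !inE /=; apply/imsetP/andP => [[j]|[kB ki]].
  by rewrite !inE /= => /and3P[jB _ ji] ->; rewrite (block_perms_mem _ gp Bp).
exists ((g^-1)%g k); last by rewrite permKV.
have jB : (g^-1)%g k \in B by rewrite -(block_perms_mem _ gp Bp) permKV.
by rewrite !inE /= jB permKV ki andbT same_blockE (pblock_def Bp jB).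
Qed.

(** [perm_ordering] is a bijection from the block-preserving permutations to the families of
    orderings: both are determined by ranks inside the blocks. *)
Lemma card_block_orderings p : #|block_orderings p| = part_fact p.
Proof.
have -> : part_fact p = #|block_perms p setT|.
  by rewrite card_block_perms; apply: eq_bigr => B _; rewrite setIT.
have po_inj : {in block_perms p setT &, injective (perm_ordering p)}.
  move=> g h gp hp e; apply/permP => i; have ip := pblock_in p i.
  have mi f : f \in block_perms p setT -> f i \in pblock p i.
    by move=> fp; rewrite (block_perms_mem _ fp ip) pblock_self.
  apply: (rank_inj (ord_order_linear (pblock p i))); rewrite ?mi //.
  rewrite -(rank_perm_ordering gp ip) ?pblock_self // e.
  by rewrite rank_perm_ordering ?pblock_self.
rewrite -(card_in_imset po_inj); apply: eq_card => L.
apply/idP/imsetP => [|[g _ ->]]; last exact: perm_ordering_in.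
rewrite inE => /andP[/subsetP sL /forall_inP linL].
(* Preimage of L: i goes to the element of its block whose natural rank is the rank of i in L; it
   exists by [rank_onto] for both orders. *)
pose P i k := (k \in pblock p i) &&
  (rank (pblock p i) L i == rank (pblock p i) ord_order k).
pose f i := odflt i [pick k | P i k].
have fP i : P i (f i).
  rewrite /f; case: pickP => //= nP; have lin := linL _ (pblock_in p i).
  have : inord (rank (pblock p i) L i) \in [set~ @ord0 #|pblock p i|].
    by rewrite -(rank_onto lin); apply/imsetP; exists i; rewrite ?pblock_self.
  rewrite -(rank_onto (ord_order_linear _)) => /imsetP[k kB /(congr1 val)] /=.
  have rB M j : (rank (pblock p i) M j < #|pblock p i|.+1)%N.
    rewrite ltnS subset_leq_card //.
    by apply/subsetP => l; rewrite inE => /andP[].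
  by rewrite !inordK // => e; have := nP k; rewrite /P kB e eqxx.
have fB i : pblock p (f i) = pblock p i.
  by apply: pblock_def; rewrite ?pblock_in //; case/andP: (fP i).
have fr i : rank (pblock p i) L i = rank (pblock p i) ord_order (f i).
  by apply/eqP; case/andP: (fP i).
have f_inj : injective f.
  move=> i j e; have eB : pblock p i = pblock p j by rewrite -fB e fB.
  apply: (rank_inj (linL _ (pblock_in p i))); rewrite ?pblock_self //.
    by rewrite eB pblock_self.
  by rewrite fr e eB -fr.
exists (perm f_inj).
  apply/block_permsP; split=> [|i]; last by rewrite permE.
  by apply/subsetP => j _; rewrite inE.
apply/setP => -[i j]; rewrite !inE /= !permE.
(* A pair from different blocks is on neither side, as L lies in the union of the squares of the
   blocks. *)
case: (boolP (same_block p i j)) => ij; last first.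
  apply: contraNF ij => /sL/bigcupP[B Bp]; rewrite inE /= => /andP[iB jB].
  by rewrite same_blockE (pblock_def Bp iB).
have jB : j \in pblock p i by rewrite -same_blockE.
have eB := eqP ij.
rewrite -(leq_rank (linL _ (pblock_in p i))) ?pblock_self //.
have -> : rank (pblock p i) L j = rank (pblock p i) ord_order (f j).
  by rewrite eB fr.
rewrite fr (leq_rank (ord_order_linear _)) ?inE //.
  by rewrite -fB pblock_self.
by rewrite eB -fB pblock_self.
Qed.

End BlockOrderings.

(** * Coefficients and the bilinear form *)

Local Notation ker := Defs.ker.

Section Coefficients.
Variable n : nat.
Implicit Types (p q r s : setpart n) (t u : n.-tuple nat).

Lemma same_block_ker t i j : same_block (ker t) i j = (tnth t i == tnth t j).
Proof.
rewrite same_blockE /= /preim_partition pblock_equivalence_partition ?inE //.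
by move=> x y z _ _ _ /=; split=> // /eqP ->.
Qed.

Lemma same_block_meet p q i j :
  same_block (p `&` q)%O i j = same_block p i j && same_block q i j.
Proof. exact: partition_of_relE. Qed.

Lemma same_block_bot i j : same_block (\bot%O : setpart n) i j = (i == j).
Proof. by rewrite same_blockE pblock_bot inE eq_sym. Qed.

Lemma tuple_sumE (c : n.-tuple nat -> rat) t : tuple_sum c t = c t.
Proof. by rewrite /tuple_sum valK. Qed.

Lemma tuple_sum_size (c : n.-tuple nat -> rat) w :
  size w <> n -> tuple_sum c w = 0.
Proof. by move=> nw; rewrite /tuple_sum; case: insubP => // u /eqP. Qed.

Lemma m_coef p t : m_series p t = (p == ker t)%:R.
Proof.
rewrite /m_series tuple_sumE; congr (nat_of_bool _)%:R.
apply/'forall_'forall_eqP/eqP => [h|e j k]; last by rewrite e same_block_ker.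
by apply: setpart_eq => j k; rewrite same_block_ker h.
Qed.

Lemma p_coef p t : p_series p t = (p <= ker t)%O%:R.
Proof.
rewrite /p_series tuple_sumE; congr (nat_of_bool _)%:R.
apply/'forall_'forall_implyP/refinesP => h j k.
  by rewrite same_block_ker => /h.
by move/h; rewrite same_block_ker.
Qed.

Lemma e_coef p t : e_series p t = ((ker t `&` p)%O == \bot%O)%:R.
Proof.
rewrite /e_series tuple_sumE; congr (nat_of_bool _)%:R; rewrite -lex0.
apply/'forall_'forall_implyP/refinesP => h j k.
  rewrite same_block_meet same_block_ker same_block_bot => /andP[tjk pjk].
  by apply: contraTT tjk => jk; apply: h; rewrite jk.
case/andP => jk pjk; apply: contraNN jk => tjk.
rewrite -same_block_bot; apply: h.
by rewrite same_block_meet same_block_ker tjk.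
Qed.

Lemma h_coef p t : h_series p t = (part_fact (ker t `&` p)%O)%:R.
Proof. by rewrite /h_series tuple_sumE card_block_orderings. Qed.

(** * Words with a prescribed kernel *)

Definition kword p : n.-tuple nat := [tuple val (rep p i) | i < n].

Lemma ker_kword p : ker (kword p) = p.
Proof.
apply: setpart_eq => i j; rewrite same_block_ker !tnth_mktuple.
by rewrite val_eqE eq_rep.
Qed.

Definition nat_swap (a b x : nat) :=
  if x == a then b else if x == b then a else x.

Lemma nat_swapK a b : involutive (nat_swap a b).
Proof.
move=> x; rewrite /nat_swap; case: (eqVneq x a) => [->|xa].
  by rewrite eqxx; case: eqVneq.
by case: (eqVneq x b) => [->|xb]; rewrite ?eqxx // (negPf xa) (negPf xb).
Qed.

(** The bijection must act on all letters, so it is built along prefixes, composing with one swap at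
    each new position. *)
Lemma ker_eq_bij t u : ker t = ker u ->
  exists2 s : nat -> nat, bijective s & map_tuple s t = u.
Proof.
move=> ktu; have eq_tu i j : (tnth t i == tnth t j) = (tnth u i == tnth u j).
  by rewrite -!same_block_ker ktu.
suff /(_ n)[s sb st] : forall k, exists2 s : nat -> nat, bijective s &
    forall i : 'I_n, (i < k)%N -> s (tnth t i) = tnth u i.
  by exists s => //; apply: eq_from_tnth => i; rewrite tnth_map st.
elim=> [|k [s sb st]]; first by exists id => //; exists id.
case: (ltnP k n) => [kn|nk]; last first.
  by exists s => // i _; apply: st; apply: leq_trans nk.
(* An earlier letter equal to the new one makes the swap trivial, and any other is fixed by it,
   since the kernels agree. *)
pose x := Ordinal kn; pose z := nat_swap (s (tnth t x)) (tnth u x).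
exists (z \o s) => [|i].
  by apply: bij_comp => //; exists z; apply: nat_swapK.
rewrite ltnS leq_eqVlt => /predU1P[ik|ik] /=.
  have -> : i = x by apply: val_inj.
  by rewrite /z /nat_swap eqxx.
rewrite /z /nat_swap (inj_eq (bij_inj sb)) eq_tu (st i ik).
by case: (eqVneq (tnth u i) (tnth u x)).
Qed.

Lemma ncsym_ker (f : ncsym) t u : ker t = ker u -> f t = f u.
Proof.
case/ker_eq_bij => s sb <-; have /asboolP[_ fs] := nccoefP f.
by rewrite -(fs s sb).
Qed.

End Coefficients.

(** * Coordinates with respect to the power sums *)

Lemma nccoefD a (f g : ncsym) w : (a *: f + g) w = a * f w + g w.
Proof. by []. Qed.

Lemma nccoef_lincomb (I : finType) (P : pred I) (c : I -> rat) (F : I -> ncsym)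
    w :
  (\sum_(i | P i) c i *: F i) w = \sum_(i | P i) c i * F i w.
Proof. exact: (big_morph (fun f : ncsym => f w)). Qed.

Lemma nccoef_sum (I : finType) (P : pred I) (F : I -> ncsym) w :
  (\sum_(i | P i) F i) w = \sum_(i | P i) F i w.
Proof. exact: (big_morph (fun f : ncsym => f w)). Qed.


(* The coefficient of p_p in f: the value of p_q at [kword r] is 1 if q <= r and
   0 otherwise, so that f (kword r) is the sum of the coefficients of the p_q
   with q <= r. *)
Definition pcoef (f : ncsym) n (p : setpart n) : rat :=
  \sum_(q : setpart n | (q <= p)%O) mobius q p * f (kword q).

Lemma pcoef_linear n (p : setpart n) :
  GRing.linear_for *%R (fun f => pcoef f p).
Proof.
move=> a f g; rewrite /pcoef mulr_sumr -big_split /=; apply: eq_bigr => q _.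
by rewrite [X in _ * X = _]nccoefD mulrDr mulrCA.
Qed.

(** After exchanging the sums, [A r] is multiplied by the sum of [mobius q p] over q between r and
    p, which [mobius_suml] evaluates. *)
Lemma pcoefP (f : ncsym) n (A : setpart n -> rat) :
  (forall r : setpart n, f (kword r) = \sum_(q : setpart n | (q <= r)%O) A q) ->
  forall p : setpart n, pcoef f p = A p.
Proof.
move=> fA p; rewrite /pcoef.
under eq_bigr => q _ do rewrite fA mulr_sumr.
rewrite (exchange_big_dep (fun r => (r <= p)%O)) /=; last first.
  by move=> q r qp rq; apply: le_trans rq qp.
rewrite (bigD1 p) //= [X in _ + X]big1 ?addr0 => [|r /andP[rp nrp]].
  rewrite -mulr_suml (eq_bigl (fun q => (p <= q <= p)%O)); last first.
    by move=> q; rewrite andbC.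
  by rewrite mobius_suml eqxx mul1r.
rewrite -mulr_suml (eq_bigl (fun q => (r <= q <= p)%O)); last first.
  by move=> q; rewrite andbC.
by rewrite mobius_suml (negPf nrp) mul0r.
Qed.

(** The converse inversion, resting on [mobius_sumr]. *)
Lemma pcoef_sum (f : ncsym) n (r : setpart n) :
  \sum_(q : setpart n | (q <= r)%O) pcoef f q = f (kword r).
Proof.
rewrite /pcoef (exchange_big_dep (fun q => (q <= r)%O)) /=; last first.
  by move=> p q pr qp; apply: le_trans qp pr.
rewrite (bigD1 r) //= [X in _ + X]big1 ?addr0 => [|q /andP[qr nqr]].
  rewrite -mulr_suml (eq_bigl (fun p => (r <= p <= r)%O)); last first.
    by move=> q; rewrite andbC.
  by rewrite mobius_sumr eqxx mul1r.
rewrite -mulr_suml (eq_bigl (fun p => (q <= p <= r)%O)); last first.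
  by move=> p; rewrite andbC.
by rewrite mobius_sumr (negPf nqr) mul0r.
Qed.

Lemma pcoef_size (f : ncsym) n (p : setpart n) :
  (forall w, size w = n -> f w = 0) -> pcoef f p = 0.
Proof.
by move=> f0; rewrite /pcoef big1 // => q _; rewrite f0 ?mulr0 ?size_tuple.
Qed.

(** Every word has the coefficient of the standard word with the same kernel, and [pcoef_sum]
    recovers the latter. *)
Lemma ncsym_ext (f g : ncsym) :
  (forall n (p : setpart n), pcoef f p = pcoef g p) -> f = g.
Proof.
move=> fg; apply: val_inj; apply/funext => w /=.
have e (h : ncsym) : h w = h (kword (ker (in_tuple w))).
  by rewrite -(@ncsym_ker _ h (in_tuple w)) // ker_kword.
by rewrite !e -!pcoef_sum; apply: eq_bigr.
Qed.

(** * Construction of the form degree by degree *)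

Lemma ncsym_bounded (f : ncsym) : bounded_degree f.
Proof. by have /asboolP[] := nccoefP f. Qed.

(** A chosen degree bound rather than the exact degree; [ncform_ge] makes the form independent of
    the choice. *)
Definition ncdeg (f : ncsym) : nat := sval (cid (ncsym_bounded f)).

Lemma pcoef_gtdeg (f : ncsym) n (p : setpart n) :
  (ncdeg f < n)%N -> pcoef f p = 0.
Proof.
rewrite /ncdeg; case: cid => d /= fd dn.
by apply: pcoef_size => w wn; apply: fd; rewrite wn.
Qed.

Definition ncform_deg n (f g : ncsym) : rat :=
  n`!%:R * \sum_(p : setpart n) pcoef f p * pcoef g p / `|mobius \bot%O p|.

Definition ncform (f g : ncsym) : rat :=
  \sum_(n < (ncdeg f).+1) ncform_deg n f g.

(** Terms beyond the bound of f vanish with its coordinates, so several series can be summed up to a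
    common bound. *)
Lemma ncform_ge (f g : ncsym) d : (ncdeg f < d)%N ->
  ncform f g = \sum_(n < d) ncform_deg n f g.
Proof.
move=> fd; rewrite /ncform (big_ord_widen d (fun n => ncform_deg n f g) fd).
rewrite big_mkcond /=.
apply: eq_bigr => n _; case: ifP => // /negbT; rewrite -ltnNge => fn.
rewrite /ncform_deg big1 ?mulr0 // => p _.
by rewrite pcoef_gtdeg ?mul0r // ltnW.
Qed.

Lemma ncform_deg_bilinear n : bilinear_for *%R *%R (ncform_deg n).
Proof.
split=> h a f g; rewrite /= /ncform_deg [RHS]addrC mulrCA -mulrDr;
  congr (_ * _); rewrite [RHS]addrC mulr_sumr -big_split /=;
  apply: eq_bigr => p _; rewrite pcoef_linear.
  by rewrite !mulrDl !mulrA.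
by rewrite mulrDr mulrDl mulrCA !mulrA.
Qed.

Lemma ncform_bilinear : bilinear_for *%R *%R ncform.
Proof.
split=> h a f g.
  (* Linearity on the left involves three series with possibly different cutoffs, and d exceeds all
     three bounds. On the right the cutoff comes from the fixed argument. *)
  pose d := (maxn (ncdeg (a *: f + g)) (maxn (ncdeg f) (ncdeg g))).+1.
  rewrite !(@ncform_ge _ _ d) ?ltnS ?leq_max ?leqnn ?orbT //.
  rewrite /= mulr_sumr -big_split /=; apply: eq_bigr => n _.
  exact: (ncform_deg_bilinear n).1.
rewrite /= /ncform mulr_sumr -big_split /=; apply: eq_bigr => n _.
exact: (ncform_deg_bilinear n).2.
Qed.

HB.instance Definition _ :=
  bilinear_isBilinear.Build rat ncsym ncsym rat *%R *%R ncform ncform_bilinear.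

(* a_p = sum_q A(p, q) p_q, evaluated at the words [kword r] (see [pcoef]), and
   A' is the inverse matrix of A. *)
Definition pexpansion (a : forall n, setpart n -> ncsym)
    (A A' : forall n, setpart n -> setpart n -> rat) : Prop :=
  forall n (p : setpart n),
  [/\ forall w, size w <> n -> a n p w = 0,
      forall r, a n p (kword r) = \sum_(q : setpart n | (q <= r)%O) A n p q
    & forall r, \sum_q A' n p q * A n q r = (p == r)%:R].

Section Expansions.
Variables (a : forall n, setpart n -> ncsym).
Variables (A A' : forall n, setpart n -> setpart n -> rat).
Hypothesis aA : pexpansion a A A'.

Lemma pcoef_exp n (p q : setpart n) : pcoef (a p) q = A p q.
Proof. by have [_ /pcoefP] := aA p. Qed.

Lemma pcoef_exp_neq k n (p : setpart n) (q : setpart k) :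
  k <> n -> pcoef (a p) q = 0.
Proof.
move=> kn; have [a0 _ _] := aA p; apply: pcoef_size => w wk.
by apply: a0; rewrite wk.
Qed.

(** Both sides have the same coordinates: in degree n because A' times A is the identity, and in
    other degrees because all of them vanish. *)
Lemma ncp_exp n (p : setpart n) : ncp p = \sum_q A' p q *: a q.
Proof.
apply: ncsym_ext => k r.
have [kn|/eqP kn] := eqVneq k n; last first.
  transitivity (0 : rat); [| symmetry]; apply: pcoef_size => w wk.
    by apply: tuple_sum_size; rewrite wk.
  rewrite nccoef_lincomb big1 // => q _.
  by have [-> //] := aA q; rewrite ?mulr0 // wk.
case: n / kn p => p.
rewrite (@pcoefP _ _ (fun q => (p == q)%:R)); last first.
  move=> q; rewrite [LHS](p_coef p) ker_kword; case: (boolP (p <= q)%O) => pq.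
    rewrite (bigD1 p) //= eqxx big1 ?addr0 // => s /andP[_ sp].
    by rewrite eq_sym (negPf sp).
  rewrite big1 // => s sq; case: eqP => // ps.
  by rewrite ps sq in pq.
apply/esym/(@pcoefP _ _ (fun q => (p == q)%:R)) => q; rewrite nccoef_lincomb.
have -> : \sum_s A' p s * a s (kword q) =
    \sum_s \sum_(r | (r <= q)%O) A' p s * A s r.
  by apply: eq_bigr => s _; have [_ -> _] := aA s; rewrite mulr_sumr.
rewrite exchange_big /=; apply: eq_bigr => s _.
by have [_ _ ->] := aA p.
Qed.

End Expansions.

(** * Spanning and uniqueness of the form *)

Lemma ncdegP (f : ncsym) w : (ncdeg f < size w)%N -> f w = 0.
Proof. by rewrite /ncdeg; case: cid => d /= fd /fd. Qed.

(** At a word w only the degree [size w] survives; there the partitions below the kernel of w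
    contribute, and [pcoef_sum] adds their coordinates. *)
Lemma ncsym_sum_ncp (f : ncsym) :
  f = \sum_(n < (ncdeg f).+1) \sum_(p : setpart n) pcoef f p *: ncp p.
Proof.
apply: val_inj; apply/funext => w /=; rewrite nccoef_sum.
have p0 n (p : setpart n) : n <> size w -> ncp p w = 0.
  by move=> nw; apply: tuple_sum_size => /esym.
have [wf|fw] := ltnP (size w) (ncdeg f).+1; last first.
  rewrite ncdegP // big1 // => n _; rewrite nccoef_lincomb big1 // => p _.
  rewrite p0 ?mulr0 // => nw.
  by have := ltn_ord n; rewrite nw ltnNge fw.
rewrite (bigD1 (Ordinal wf)) //= [X in _ + X]big1 ?addr0 => [|n nw]; last first.
  rewrite nccoef_lincomb big1 // => p _; rewrite p0 ?mulr0 // => e.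
  by move/eqP: nw; apply; apply: val_inj.
rewrite nccoef_lincomb; pose t := in_tuple w.
have -> : f w = f (kword (ker t)).
  by rewrite -(@ncsym_ker _ f t) // ker_kword.
rewrite -pcoef_sum big_mkcond; apply: eq_bigr => p _.
by rewrite [X in _ = _ * X](p_coef p t); case: ifP; rewrite ?mulr1 ?mulr0.
Qed.

(** The power sums span by [ncsym_sum_ncp], and lie in the span of the family by [ncp_exp]. *)
Lemma scalar_eq a A A' (phi psi : {scalar ncsym}) : pexpansion a A A' ->
  (forall n (p : setpart n), phi (a n p) = psi (a n p)) -> phi =1 psi.
Proof.
move=> aA ap f; rewrite (ncsym_sum_ncp f) !linear_sum; apply: eq_bigr => n _.
rewrite !linear_sum; apply: eq_bigr => p _; rewrite !linearZ /=; congr (_ * _).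
rewrite (ncp_exp aA) !linear_sum; apply: eq_bigr => q _.
by rewrite !linearZ /= ap.
Qed.

Lemma biscalar_eq a A A' b C C' (B B' : {biscalar ncsym}) :
  pexpansion a A A' -> pexpansion b C C' ->
  (forall k n (p : setpart k) (s : setpart n),
     B (a k p) (b n s) = B' (a k p) (b n s)) ->
  B =2 B'.
Proof.
move=> aA bC eq_ab f.
apply: (@scalar_eq _ _ _ (B f) (B' f) bC) => n s.
exact: (@scalar_eq _ _ _ (applyr B (b n s)) (applyr B' (b n s)) aA
  (fun k p => eq_ab k n p s) f).
Qed.

(** Reduces each formula to a matrix identity in a single degree; uniqueness comes from
    [biscalar_eq]. *)
Lemma defined_by_ncform a A A' b C C' F :
  pexpansion a A A' -> pexpansion b C C' ->
  (forall n p s, n`!%:R * (\sum_t A n p t * C n s t / `|mobius \bot%O t|) =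
                 F n p s) ->
  defined_by a b F ncform.
Proof.
move=> aA bC FE; have vals : has_values a b F ncform.
  split=> [n p s|k n p s kn].
    (* The bound N ensures that degree n, the only one that contributes, occurs in the sum. *)
    pose N := (maxn (ncdeg (a n p)) n).+1.
    rewrite -FE [LHS](@ncform_ge _ _ N) ?ltnS ?leq_maxl //.
    have nN : (n < N)%N by rewrite ltnS leq_maxr.
    rewrite (bigD1 (Ordinal nN)) //= [X in _ + X]big1 ?addr0 => [|k kn].
      congr (_ * _); apply: eq_bigr => t _.
      by rewrite (pcoef_exp aA) (pcoef_exp bC).
    rewrite /ncform_deg big1 ?mulr0 // => t _.
    by rewrite (pcoef_exp_neq aA) ?mul0r // => e; case/eqP: kn; apply: val_inj.
  apply: big1 => m _; rewrite /ncform_deg big1 ?mulr0 // => t _.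
  (* A nonzero term of degree m would need both m = k and m = n. *)
  have [e|/eqP mk] := eqVneq (m : nat) k; last first.
    by rewrite (pcoef_exp_neq aA) ?mul0r.
  by rewrite (pcoef_exp_neq bC) ?mulr0 ?mul0r // e.
split=> // B' [B'n B'k] f g.
apply: (biscalar_eq aA bC) => k n p s.
have [e|/eqP kn] := eqVneq k n; last by rewrite B'k // vals.2.
by case: n / e s => s; rewrite B'n vals.1.
Qed.

(** * The four bases *)

Lemma ncp_pexpansion :
  pexpansion ncp (fun n p q => (p == q)%:R) (fun n p q => (p == q)%:R).
Proof.
have sum_eq n (p : setpart n) (P : pred (setpart n)) :
    \sum_(q | P q) (p == q)%:R = (P p)%:R :> rat.
  rewrite big_mkcond (bigD1 p) //= eqxx big1 ?addr0 => [|q qp]; last first.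
    by rewrite eq_sym (negPf qp) if_same.
  by case: (P p).
move=> n p; split=> [w nw|r|r]; first exact: tuple_sum_size.
- by rewrite [LHS](p_coef p) ker_kword sum_eq.
- rewrite (bigD1 p) //= eqxx mul1r big1 ?addr0 // => q qp.
  by rewrite eq_sym (negPf qp) mul0r.
Qed.

(** At [kword r] the series is the indicator of p = r, which [mobius_sumr] writes as an interval
    sum; [mobius_suml] gives the inverse matrix. *)
Lemma ncm_pexpansion :
  pexpansion ncm (fun n p q => mobius p q) (fun n p q => zeta p q).
Proof.
move=> n p; split=> [w nw|r|r]; first exact: tuple_sum_size.
- rewrite [LHS](m_coef p) ker_kword -mobius_sumr.
  rewrite [LHS]big_mkcond [RHS]big_mkcond /=.
  apply: eq_bigr => q _; case: (boolP (p <= q)%O) => // /mobius_nle ->.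
  by rewrite if_same.
- rewrite -mobius_suml [RHS]big_mkcond; apply: eq_bigr => q _.
  rewrite /zeta; case: (boolP (q <= r)%O) => [_|/mobius_nle ->].
    by rewrite andbT; case: ifP; rewrite ?mul1r ?mul0r.
  by rewrite andbF mulr0.
Qed.

(** Common pattern of e and h: A is the transposed order matrix with columns scaled by c, so A' is
    the transposed Möbius matrix with rows divided by c. *)
Lemma lower_pexpansion (a : forall n, setpart n -> ncsym)
    (c : forall n, setpart n -> rat) :
  (forall n (p : setpart n), c n p != 0) ->
  (forall n (p : setpart n) w, size w <> n -> a n p w = 0) ->
  (forall n (p r : setpart n), a n p (kword r) =
     \sum_(q : setpart n | (q <= r `&` p)%O) c n q) ->
  pexpansion a (fun n p q => zeta q p * c n q)
    (fun n p q => mobius q p / c n p).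
Proof.
move=> c0 a0 ac n p; split=> [|r|r]; first exact: a0.
  rewrite ac big_mkcond [RHS]big_mkcond; apply: eq_bigr => q _.
  rewrite lexI /zeta; case: (q <= r)%O => //=.
  by case: (q <= p)%O; rewrite ?mul1r ?mul0r.
transitivity (c n r / c n p *
  \sum_(q : setpart n | (r <= q <= p)%O) mobius q p).
  rewrite mulr_sumr [RHS]big_mkcond; apply: eq_bigr => q _; rewrite /zeta.
  case: (boolP (q <= p)%O) => [_|/mobius_nle ->]; last first.
    by rewrite andbF !mul0r.
  rewrite andbT; case: (r <= q)%O; last by rewrite mul0r mulr0.
  by rewrite mul1r -mulrA mulrC [c n r * _]mulrC.
rewrite mobius_suml eq_sym; case: eqP => [->|_]; last by rewrite mulr0.
by rewrite mulr1 divff.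
Qed.

(** The weights sum, over the partitions below the meet, to the indicator that the meet is [\bot],
    the coefficient found in [e_coef]. *)
Lemma nce_pexpansion :
  pexpansion nce (fun n p q => zeta q p * mobius \bot%O q)
    (fun n p q => mobius q p / mobius \bot%O p).
Proof.
apply: lower_pexpansion => [n p|n p w nw|n p r]; first exact: mobius_bot_neq0.
  exact: tuple_sum_size.
rewrite [LHS](e_coef p) ker_kword eq_sym -mobius_sumr.
by apply: eq_bigl => q; rewrite le0x.
Qed.

(** The weights sum to the number of orderings by [sum_norm_mobius_bot]. *)
Lemma nch_pexpansion :
  pexpansion nch (fun n p q => zeta q p * `|mobius \bot%O q|)
    (fun n p q => mobius q p / `|mobius \bot%O p|).
Proof.
apply: lower_pexpansion => [n p|n p w nw|n p r].
- by rewrite normr_eq0 mobius_bot_neq0.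
- exact: tuple_sum_size.
- by rewrite [LHS](h_coef p) ker_kword -sum_norm_mobius_bot.
Qed.

(** * Summation rules and the ten formulas *)

Lemma mobius_botE n (t : setpart n) :
  mobius \bot%O t = part_sign t * `|mobius \bot%O t|.
Proof. by rewrite norm_mobius_bot mulrA part_sign_sqr mul1r. Qed.

Lemma sum_zeta_meet n (p s : setpart n) (F : setpart n -> rat) :
  \sum_t zeta t p * zeta t s * F t =
  \sum_(t : setpart n | (t <= p `&` s)%O) F t.
Proof.
rewrite [RHS]big_mkcond; apply: eq_bigr => t _; rewrite lexI /zeta -natrM mulnb.
by case: ifP; rewrite ?mul1r ?mul0r.
Qed.

Lemma sum_zeta_mobius n (p s : setpart n) (F : setpart n -> rat) :
  \sum_t zeta t p * mobius s t * F t =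
  \sum_(t : setpart n | (s <= t <= p)%O) mobius s t * F t.
Proof.
rewrite [RHS]big_mkcond; apply: eq_bigr => t _; rewrite /zeta.
case: (boolP (s <= t)%O) => [_|/mobius_nle ->]; last by rewrite mulr0 mul0r.
by rewrite /=; case: ifP; rewrite ?mul1r ?mul0r.
Qed.

Lemma sum_delta n (p : setpart n) (F : setpart n -> rat) :
  \sum_t (p == t)%:R * F t = F p.
Proof.
rewrite (bigD1 p) //= eqxx mul1r big1 ?addr0 // => t tp.
by rewrite eq_sym (negPf tp) mul0r.
Qed.

Theorem theorem4p4 :
  exists2 B : {biscalar ncsym},
    defined_by ncm nch (fun n p s => n`!%:R * (p == s)%:R) B &
    defined_by nce nce (fun n p s => n`!%:R * (part_fact (p `&` s)%O)%:R) B /\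
    defined_by nce nch (fun n p s => n`!%:R * ((p `&` s)%O == \bot%O)%:R) B /\
    defined_by nce ncp (fun n p s => part_sign s * n`!%:R * zeta s p) B /\
    defined_by nce ncm (fun n p s =>
      part_sign s * n`!%:R * (lambda_fact s p)%:R * zeta s p) B /\
    defined_by nch nch (fun n p s => n`!%:R * (part_fact (p `&` s)%O)%:R) B /\
    defined_by nch ncp (fun n p s => n`!%:R * zeta s p) B /\
    defined_by nch ncm (fun n p s => n`!%:R * (p == s)%:R) B /\
    defined_by ncp ncp (fun n p s =>
      n`!%:R * ((p == s)%:R / `|mobius \bot%O p|)) B /\
    defined_by ncp ncm (fun n p s =>
      n`!%:R * (mobius s p * zeta s p / `|mobius \bot%O p|)) B /\
    defined_by ncm ncm (fun n p s =>
      n`!%:R * \sum_(t : setpart n | (p `|` s <= t)%O)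
                 (mobius p t * mobius s t / `|mobius \bot%O t|)) B.
Proof.
have M0 n (t : setpart n) : `|mobius \bot%O t| != 0.
  by rewrite normr_eq0 mobius_bot_neq0.
have sqr n (t : setpart n) :
    mobius \bot%O t * mobius \bot%O t / `|mobius \bot%O t| = `|mobius \bot%O t|.
  rewrite {1 2}mobius_botE mulrACA part_sign_sqr mul1r -mulrA divff //.
  by rewrite mulr1.
have sgn n (t : setpart n) :
    mobius \bot%O t / `|mobius \bot%O t| = part_sign t.
  by rewrite {1}mobius_botE -mulrA divff ?mulr1.
(* Shared by the pairings of m with h and of h with m: the weight of h cancels the denominator. *)
have hm n (p s : setpart n) : n`!%:R * (\sum_t zeta t p * `|mobius \bot%O t| *
    mobius s t / `|mobius \bot%O t|) = n`!%:R * (p == s)%:R.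
  congr (_ * _); rewrite eq_sym -mobius_sumr.
  transitivity (\sum_t zeta t p * mobius s t * 1).
    by apply: eq_bigr => t _; rewrite mulr1 [_ * mobius s t]mulrAC mulfK.
  by rewrite sum_zeta_mobius; apply: eq_bigr => t _; rewrite mulr1.
exists ncform.
  apply: defined_by_ncform ncm_pexpansion nch_pexpansion _ => n p s.
  rewrite eq_sym -hm; congr (_ * _); apply: eq_bigr => t _.
  by rewrite [mobius p t * _]mulrC.
split; last split; last split; last split; last split; last split;
  last split; last split; last split.
(* By [sqr] the terms reduce to absolute Möbius values, whose sum below the meet is its
   factorial. *)
- apply: defined_by_ncform nce_pexpansion nce_pexpansion _ => n p s.
  rewrite -sum_norm_mobius_bot -sum_zeta_meet; congr (_ * _).
  apply: eq_bigr => t _.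
  by rewrite mulrACA -[LHS]mulrA sqr.
(* One signed Möbius value survives in each term, and these sum to a delta. *)
- apply: defined_by_ncform nce_pexpansion nch_pexpansion _ => n p s.
  rewrite eq_sym -mobius_sumr; congr (_ * _).
  under [RHS]eq_bigl => t do rewrite le0x.
  rewrite -sum_zeta_meet; apply: eq_bigr => t _.
  by rewrite mulrACA -[LHS]mulrA mulfK.
- apply: defined_by_ncform nce_pexpansion ncp_pexpansion _ => n p s.
  rewrite [_ * n`!%:R]mulrC -mulrA; congr (_ * _).
  under eq_bigr => t _ do rewrite [_ * (s == t)%:R]mulrC -!mulrA sgn.
  by rewrite sum_delta mulrC.
- apply: defined_by_ncform nce_pexpansion ncm_pexpansion _ => n p s.
  rewrite [_ * n`!%:R]mulrC -!mulrA; congr (_ * _).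
  (* The sign of t times the Möbius value at (s, t) is the sign of s times its absolute value, so
     the sum over the interval gives the factorial of lambda. *)
  transitivity (\sum_t zeta t p * mobius s t * part_sign t).
    by apply: eq_bigr => t _; rewrite [_ * mobius s t]mulrAC -[LHS]mulrA sgn.
  rewrite sum_zeta_mobius /zeta.
  case: (boolP (s <= p)%O) => sp; last first.
    rewrite !mulr0 big_pred0 // => t; apply/negP => /andP[st tp].
    by rewrite (le_trans st tp) in sp.
  rewrite mulr1 -sum_norm_mobius_lambda // mulr_sumr; apply: eq_bigr => t _.
  by rewrite norm_mobius !mulrA part_sign_sqr mul1r mulrC.
- apply: defined_by_ncform nch_pexpansion nch_pexpansion _ => n p s.
  rewrite -sum_norm_mobius_bot -sum_zeta_meet; congr (_ * _).
  apply: eq_bigr => t _.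
  by rewrite mulrACA -[LHS]mulrA mulfK.
- apply: defined_by_ncform nch_pexpansion ncp_pexpansion _ => n p s.
  congr (_ * _).
  under eq_bigr => t _ do rewrite [_ * (s == t)%:R]mulrC -!mulrA divff // mulr1.
  by rewrite sum_delta.
- by apply: defined_by_ncform nch_pexpansion ncm_pexpansion _.
- apply: defined_by_ncform ncp_pexpansion ncp_pexpansion _ => n p s.
  under eq_bigr => t _ do rewrite -mulrA.
  by rewrite sum_delta [s == p]eq_sym.
- apply: defined_by_ncform ncp_pexpansion ncm_pexpansion _ => n p s.
  under eq_bigr => t _ do rewrite -mulrA.
  rewrite sum_delta /zeta; case: (boolP (s <= p)%O) => [_|/mobius_nle ->].
    by rewrite mulr1.
  by rewrite !mul0r.
- apply: defined_by_ncform ncm_pexpansion ncm_pexpansion _ => n p s.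
  (* The two Möbius values are both nonzero only for t above p and s, that is, above their join. *)
  congr (_ * _); rewrite [RHS]big_mkcond; apply: eq_bigr => t _.
  rewrite leUx; case: (boolP (p <= t)%O) => [_|/mobius_nle ->].
    by case: (boolP (s <= t)%O) => // /mobius_nle ->; rewrite mulr0 mul0r.
  by rewrite !mul0r.
Qed.
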